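(* Let $m<n$ be positive integers, let $M\in\mathbb R^{n\times n}$ be symmetric positive definite, $A\in\mathbb R^{n\times n}$ arbitrary, $B\in\mathbb R^{m\times n}$ of full rank $m$, and $\tau>0$. Consider the projection scheme $$\tfrac1\tau M\tilde v^{k+1}=(\tfrac1\tau M+A)v^k+B^{T}p^k+f^k,$$ $$-BM^{-1}B^{T}\phi^{k+1}=\tfrac2\tau\big(B\tilde v^{k+1}-g^{k+1}\big),$$ $$Mv^{k+1}=M\tilde v^{k+1}+\tfrac\tau2B^{T}\phi^{k+1},\qquad p^{k+1}=p^k+\phi^{k+1},$$ written (after shifting the time index in the second equation) as a difference-algebraic equation $\mathcal E x^{k+1}=\mathcal A x^k+h^k$ with $x^k=[\tilde v^k;\phi^k;v^k;p^k]$ and $$(\mathcal E,\mathcal A)=\left(\begin{bmatrix}\tfrac1\tau M&0&0&0\\0&0&0&0\\-M&-\tfrac\tau2B^{T}&M&0\\0&-I&0&I\end{bmatrix},\ \begin{bmatrix}0&0&\tfrac1\tau M+A&B^{T}\\-\tfrac2\tau B&-BM^{-1}B^{T}&0&0\\0&0&0&0\\0&0&0&I\end{bmatrix}\right).$$ Then the matrix pair $(\mathcal E,\mathcal A)$ is regular and of index $1$; that is, the projection scheme is a difference-algebraic equation of Kronecker index $1$.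
   Context: A pair $(\mathcal E,\mathcal A)$ of square matrices of the same size is regular if $\det(\lambda\mathcal E-\mathcal A)$ is not the zero polynomial in $\lambda$. Two pairs $(\mathcal E,\mathcal A)$ and $(\tilde{\mathcal E},\tilde{\mathcal A})$ are equivalent if $\tilde{\mathcal E}=P\mathcal E Q$ and $\tilde{\mathcal A}=P\mathcal A Q$ for some nonsingular matrices $P,Q$. A regular pair is equivalent to a pair $$\left(\begin{bmatrix}I&0\\0&N\end{bmatrix},\begin{bmatrix}J&0\\0&I\end{bmatrix}\right)$$ with $N$ nilpotent. The index of the pair, equivalently the Kronecker index of the difference-algebraic equation $\mathcal E x^{k+1}=\mathcal A x^k+h^k$, is the integer $\nu$ with $N^\nu=0$ and $N^{\nu-1}\neq0$ (in particular, the index is $1$ if $N=0$ is present with positive size). *)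

(* Defs.v *)
From mathcomp Require Import all_boot all_order all_algebra.
From mathcomp Require Import reals.

Set Implicit Arguments.
Unset Strict Implicit.
Unset Printing Implicit Defensive.

Import Order.TTheory GRing.Theory Num.Theory.
Local Open Scope ring_scope.

Section MatrixPairs.
Variable F : fieldType.

Definition regular_pair q (E A : 'M[F]_q) : Prop :=
  \det ('X *: map_mx polyC E - map_mx polyC A) != 0.

Definition equiv_pair q (E A E' A' : 'M[F]_q) : Prop :=
  exists P Q : 'M[F]_q,
    [/\ P \in unitmx, Q \in unitmx, E' = P *m E *m Q & A' = P *m A *m Q].

(* [castmx] only identifies the size r + s of the block matrices with q.
   Square matrices of any size, including 0, form a (possibly zero) ring, so
   [N ^+ nu] makes sense for s = 0.  The guard [0 < nu] is there because
   0.-1 = 0; index 0 thus means N ^+ 0 = 1%:M = 0, i.e. s = 0. *)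
Definition pair_index q (E A : 'M[F]_q) (nu : nat) : Prop :=
  exists (r s : nat) (rs : (r + s)%N = q) (J : 'M[F]_r) (N : 'M[F]_s),
    [/\ equiv_pair E A (castmx (rs, rs) (block_mx 1%:M 0 0 N))
                       (castmx (rs, rs) (block_mx J 0 0 1%:M)),
        N ^+ nu = 0
      & (0 < nu)%N -> N ^+ nu.-1 != 0].

Definition solves_dae q (E A : 'M[F]_q) (x h : nat -> 'cV[F]_q) : Prop :=
  forall k, E *m x k.+1 = A *m x k + h k.

End MatrixPairs.

Section Projection.
Variable R : realType.

Definition sym_posdef n (M : 'M[R]_n) : Prop :=
  M^T = M /\ forall x : 'cV[R]_n, x != 0 -> 0 < (x^T *m M *m x) 0 0.

Definition row4 l a b c d (Wa : 'M[R]_(l, a)) (Wb : 'M[R]_(l, b))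
    (Wc : 'M[R]_(l, c)) (Wd : 'M[R]_(l, d)) : 'M[R]_(l, a + (b + (c + d))) :=
  row_mx Wa (row_mx Wb (row_mx Wc Wd)).

Definition col4 l a b c d (Wa : 'M[R]_(a, l)) (Wb : 'M[R]_(b, l))
    (Wc : 'M[R]_(c, l)) (Wd : 'M[R]_(d, l)) : 'M[R]_(a + (b + (c + d)), l) :=
  col_mx Wa (col_mx Wb (col_mx Wc Wd)).

Section Scheme.
Variables (m n : nat) (M A : 'M[R]_n) (B : 'M[R]_(m, n)) (tau : R).

Definition proj_E : 'M[R]_(n + (m + (n + m))) :=
  col4
    (row4 (tau^-1 *: M) (0 : 'M_(n, m))         (0 : 'M_(n, n)) (0 : 'M_(n, m)))
    (row4 (0 : 'M_(m, n)) (0 : 'M_(m, m))       (0 : 'M_(m, n)) (0 : 'M_(m, m)))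
    (row4 (- M)           (- ((tau / 2) *: B^T)) M              (0 : 'M_(n, m)))
    (row4 (0 : 'M_(m, n)) (- 1%:M : 'M_(m, m))  (0 : 'M_(m, n)) (1%:M : 'M_(m, m))).

Definition proj_A : 'M[R]_(n + (m + (n + m))) :=
  col4
    (row4 (0 : 'M_(n, n)) (0 : 'M_(n, m)) (tau^-1 *: M + A) B^T)
    (row4 (- ((2 / tau) *: B)) (- (B *m invmx M *m B^T))
                                          (0 : 'M_(m, n)) (0 : 'M_(m, m)))
    (row4 (0 : 'M_(n, n)) (0 : 'M_(n, m)) (0 : 'M_(n, n)) (0 : 'M_(n, m)))
    (row4 (0 : 'M_(m, n)) (0 : 'M_(m, m)) (0 : 'M_(m, n)) (1%:M : 'M_(m, m))).

Variables (f : nat -> 'cV[R]_n) (g : nat -> 'cV[R]_m).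

(* The second equation of the scheme, relating quantities at a single time. *)
Definition increment_eq (vt : 'cV[R]_n) (phi gk : 'cV[R]_m) : Prop :=
  - (B *m invmx M *m B^T) *m phi = (2 / tau) *: (B *m vt - gk).

Definition projection_scheme (vt : nat -> 'cV[R]_n) (phi : nat -> 'cV[R]_m)
    (v : nat -> 'cV[R]_n) (p : nat -> 'cV[R]_m) : Prop :=
  forall k,
    [/\ tau^-1 *: (M *m vt k.+1)
          = (tau^-1 *: M + A) *m v k + B^T *m p k + f k,
        increment_eq (vt k.+1) (phi k.+1) (g k.+1),
        M *m v k.+1 = M *m vt k.+1 + (tau / 2) *: (B^T *m phi k.+1)
      & p k.+1 = p k + phi k.+1].

Definition proj_state (vt : nat -> 'cV[R]_n) (phi : nat -> 'cV[R]_m)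
    (v : nat -> 'cV[R]_n) (p : nat -> 'cV[R]_m) (k : nat) :
    'cV[R]_(n + (m + (n + m))) :=
  col4 (vt k) (phi k) (v k) (p k).

(* The inhomogeneity has g^k, not g^{k+1}, because the second equation is
   used with its time index shifted by one. *)
Definition proj_rhs (k : nat) : 'cV[R]_(n + (m + (n + m))) :=
  col4 (f k) ((2 / tau) *: g k) 0 0.

End Scheme.
End Projection.

(* Main.v *)
Require Import Defs.
From mathcomp Require Import all_boot all_order all_algebra.
From mathcomp Require Import reals.

Import Order.TTheory GRing.Theory Num.Theory.
Local Open Scope ring_scope.

(** The zero row block of E and its kernel have the same dimension m.  An
    element of the kernel is determined by its phi-component: vt = 0, p = phi
    and v = (tau / 2) M^-1 B^T phi.  Index 1 means that the matrix A compressed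
    from the kernel of E to the cokernel of E is invertible
    ([pair_index1_compression]): the algebraic equation then determines the
    kernel component of the state without differencing.  The cokernel is the
    second row block, in which A sends a kernel element to - S phi, where
    S = B M^-1 B^T; and S is invertible because M is positive definite and the
    rows of B are independent ([schur_unit]).

    Regularity is read off the quasi-Weierstrass form ([pair_index_regular]),
    whose pencil has determinant det (X - J) det (X N - 1). *)

(** * Regularity and index of matrix pairs *)

(** In the quasi-Weierstrass form the pencil splits into a characteristic
    matrix, whose determinant is monic, and X N - 1, whose determinant is
    nonzero at X = 0; equivalence preserves a nonzero determinant. *)
Lemma pair_index_regular (F : fieldType) q (E A : 'M[F]_q) nu :
  pair_index E A nu -> regular_pair E A.
Proof.
case=> r [s [rs [J [N [[P [Q [_ _ PEQ PAQ]]] _ _]]]]].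
case: q / rs E A P Q PEQ PAQ => E A P Q.
rewrite !castmx_id => PEQ PAQ; rewrite /regular_pair.
set pencil := 'X *: _ - _.
have pencilPQ : map_mx polyC P *m pencil *m map_mx polyC Q
    = block_mx (char_poly_mx J) 0 0 ('X *: map_mx polyC N - 1%:M).
  rewrite mulmxBr mulmxBl -scalemxAr -scalemxAl -!map_mxM -PEQ -PAQ.
  rewrite !map_block_mx !map_mx1 !map_mx0 scale_block_mx opp_block_mx.
  by rewrite add_block_mx !scaler0 !oppr0 !addr0 scalemx1.
have: \det (map_mx polyC P *m pencil *m map_mx polyC Q) != 0.
  rewrite pencilPQ det_ublock mulf_neq0 //.
    exact: monic_neq0 (char_poly_monic J).
  apply: contraTneq isT => det0.
  have: (\det ('X *: map_mx polyC N - 1%:M)).[0] == 0 by rewrite det0 horner0.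
  rewrite -horner_evalE -det_map_mx map_mxB map_mxZ map_mx1 /= horner_evalE hornerX.
  rewrite scale0r sub0r -scaleN1r detZ det1 mulr1 expf_eq0.
  by rewrite oppr_eq0 oner_eq0 andbF.
by apply: contraNneq => det0; rewrite !det_mulmx det0 mulr0 mul0r.
Qed.

(** The hypotheses on X and Y say that E has rank at least r, so that, as
    r + s = q, U spans its left kernel and V its kernel; the compression U A V
    is A seen from the kernel to the cokernel of E.  Subtracting multiples of U
    from X and of V from Y leaves X E Y unchanged and makes the off-diagonal
    blocks of A vanish, while scaling U turns the compression into 1.  For s = 0 the
    index would be 0. *)
Lemma pair_index1_compression (F : fieldType) q r s (E A : 'M[F]_q)
    (X : 'M[F]_(r, q)) (Y : 'M[F]_(q, r))
    (U : 'M[F]_(s, q)) (V : 'M[F]_(q, s)) :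
  (r + s)%N = q -> (0 < s)%N ->
  X *m E *m Y = 1%:M -> U *m E = 0 -> E *m V = 0 -> U *m A *m V \in unitmx ->
  pair_index E A 1.
Proof.
move=> rs s_gt0 XEY UE0 EV0 UAVu.
pose W := invmx (U *m A *m V) *m U.
have WE0 : W *m E = 0 by rewrite -mulmxA UE0 mulmx0.
have WAV : W *m A *m V = 1%:M by rewrite /W -!(mulmxA (invmx _)) mulVmx.
pose X' := X - X *m A *m V *m W.
pose Y' := Y - V *m (W *m A *m Y).
have X'E : X' *m E = X *m E by rewrite /X' mulmxBl -(mulmxA _ W) WE0 mulmx0 subr0.
have EY' : E *m Y' = E *m Y by rewrite /Y' mulmxBr (mulmxA E V) EV0 mul0mx subr0.
have X'AV : X' *m A *m V = 0.
  by rewrite /X' !mulmxBl -!(mulmxA _ W) -(mulmxA _ (W *m A)) WAV mulmx1 subrr.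
have WAY' : W *m A *m Y' = 0 by rewrite /Y' mulmxBr (mulmxA (W *m A) V) WAV mul1mx subrr.
have X'EY' : X' *m E *m Y' = 1%:M by rewrite X'E -mulmxA EY' mulmxA.
exists r, s, rs, (X' *m A *m Y'), 0; split=> [||_]; last first.
- by rewrite expr0 /= -mxrank_eq0 mxrank1 -lt0n.
- by rewrite expr1.
clear X'E EY' XEY UE0 UAVu; clearbody W X' Y'; clear X Y U.
case: q / rs E A V W X' Y' EV0 WE0 WAV X'AV WAY' X'EY'
  => E A V W X' Y' EV0 WE0 WAV X'AV WAY' X'EY'.
(* The inverses are explicit: [col_mx X' W] has the right inverse
   [row_mx (E *m Y') (A *m V)], and [row_mx Y' V] has the left inverse
   [col_mx (X' *m E) (W *m A)]. *)
rewrite !castmx_id; exists (col_mx X' W), (row_mx Y' V); split.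
- have : col_mx X' W *m row_mx (E *m Y') (A *m V) = 1%:M.
    by rewrite mul_col_row !mulmxA X'EY' X'AV WE0 mul0mx WAV -scalar_mx_block.
  by case/mulmx1_unit.
- have : col_mx (X' *m E) (W *m A) *m row_mx Y' V = 1%:M.
    by rewrite mul_col_row X'EY' -(mulmxA X') EV0 mulmx0 WAY' WAV -scalar_mx_block.
  by case/mulmx1_unit.
- by rewrite mul_col_mx mul_col_row X'EY' -(mulmxA X') EV0 mulmx0 WE0 !mul0mx.
- by rewrite mul_col_mx mul_col_row X'AV WAY' WAV.
Qed.

(** * Invertibility of the Schur complement *)

Lemma sym_posdef_unit (R : realType) n (M : 'M[R]_n) :
  sym_posdef M -> M \in unitmx.
Proof.
case=> _ Mpos; rewrite -row_free_unit -kermx_eq0.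
apply/rowV0P => x /sub_kermxP xM0; apply/trmx_inj/eqP; rewrite trmx0.
apply: contraTT isT => /Mpos.
by rewrite trmxK xM0 mul0mx mxE ltxx.
Qed.

(** If x S = 0 then z = M^-1 B^T x^T satisfies z^T M z = x S x^T = 0, so z = 0,
    hence x B = 0, and x = 0 because the rows of B are independent. *)
Lemma schur_unit (R : realType) m n (M : 'M[R]_n) (B : 'M[R]_(m, n)) :
  sym_posdef M -> \rank B = m -> B *m invmx M *m B^T \in unitmx.
Proof.
move=> Mspd B_full; have Mu := sym_posdef_unit _ _ _ Mspd; case: Mspd => MT Mpos.
rewrite -row_free_unit -kermx_eq0; apply/rowV0P => x /sub_kermxP.
rewrite !mulmxA => xS0.
have Bfree : row_free B by rewrite /row_free B_full.
pose z := invmx M *m (x *m B)^T.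
have z0 : z = 0.
  apply/eqP; apply: contraTT isT => /Mpos.
  rewrite /z trmx_mul trmxK trmx_inv MT mulmxKV // trmx_mul !mulmxA.
  by rewrite xS0 mul0mx mxE ltxx.
have : (x *m B)^T = 0 by rewrite -(mulKVmx Mu (x *m B)^T) -/z z0 mulmx0.
move/(congr1 trmx); rewrite trmxK trmx0 => /eqP.
by rewrite mulmx_free_eq0 // => /eqP.
Qed.

(** * The pair of the projection scheme *)

Section Scheme.
Variables (R : realType) (m n : nat) (M A : 'M[R]_n) (B : 'M[R]_(m, n)).
Variable tau : R.

Lemma mul_proj_E l (a : 'M_(n, l)) (b : 'M_(m, l)) (c : 'M_(n, l))
    (d : 'M_(m, l)) :
  proj_E M B tau *m col4 a b c d
    = col4 (tau^-1 *: (M *m a)) 0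
           (M *m c - (M *m a + (tau / 2) *: (B^T *m b))) (d - b).
Proof.
rewrite /proj_E /col4 /row4 !mul_col_mx !mul_row_col !mul0mx !mulNmx !mul1mx.
rewrite -!scalemxAl !addr0 !add0r; congr col_mx; congr col_mx; congr col_mx.
  by rewrite addrA opprD addrC.
by rewrite addrC.
Qed.

Lemma mul_proj_A l (a : 'M_(n, l)) (b : 'M_(m, l)) (c : 'M_(n, l))
    (d : 'M_(m, l)) :
  proj_A M A B tau *m col4 a b c d
    = col4 ((tau^-1 *: M + A) *m c + B^T *m d)
           (- ((2 / tau) *: (B *m a)) - B *m invmx M *m B^T *m b) 0 d.
Proof.
rewrite /proj_A /col4 /row4 !mul_col_mx !mul_row_col !mul0mx !mulNmx !mul1mx.
by rewrite -!scalemxAl !addr0 !add0r.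
Qed.

Lemma col4_inj l (a a' : 'M[R]_(n, l)) (b b' : 'M[R]_(m, l))
    (c c' : 'M[R]_(n, l)) (d d' : 'M[R]_(m, l)) :
  col4 a b c d = col4 a' b' c' d' <-> [/\ a = a', b = b', c = c' & d = d'].
Proof.
split=> [|[-> -> -> ->] //].
by move=> /eq_col_mx[-> /eq_col_mx[-> /eq_col_mx[-> ->]]].
Qed.

Lemma increment_eqE (a : 'cV_n) (b g : 'cV_m) :
  increment_eq M B tau a b g <->
  0 = - ((2 / tau) *: (B *m a)) - B *m invmx M *m B^T *m b + (2 / tau) *: g.
Proof.
rewrite /increment_eq mulNmx scalerBr; set S := _ *m b.
split=> [->|/esym/eqP].
  by rewrite addrA addNr sub0r addNr.
by rewrite addrAC addr_eq0 opprK => /eqP<-; rewrite opprD opprK.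
Qed.

(** The second block row of step k is the increment equation at time k, whereas
    step k of the scheme has it at time k + 1; the instance at time 0 makes up
    the difference. *)
Lemma solves_dae_projection_scheme (f : nat -> 'cV[R]_n) (g : nat -> 'cV[R]_m)
    (vt : nat -> 'cV[R]_n) (phi : nat -> 'cV[R]_m)
    (v : nat -> 'cV[R]_n) (p : nat -> 'cV[R]_m) :
  solves_dae (proj_E M B tau) (proj_A M A B tau)
             (proj_state vt phi v p) (proj_rhs tau f g)
  <-> projection_scheme M A B tau f g vt phi v p
      /\ increment_eq M B tau (vt 0%N) (phi 0%N) (g 0%N).
Proof.
have stepE k :
  proj_E M B tau *m proj_state vt phi v p k.+1
    = proj_A M A B tau *m proj_state vt phi v p k + proj_rhs tau f g k
  <-> [/\ tau^-1 *: (M *m vt k.+1)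
            = (tau^-1 *: M + A) *m v k + B^T *m p k + f k,
          increment_eq M B tau (vt k) (phi k) (g k),
          M *m v k.+1 = M *m vt k.+1 + (tau / 2) *: (B^T *m phi k.+1)
        & p k.+1 = p k + phi k.+1].
  rewrite mul_proj_E mul_proj_A /proj_rhs.
  rewrite {2 3}/col4 !add_col_mx !addr0 -/(col4 _ _ _ _) col4_inj.
  split=> -[-> incr Mv pS]; split=> //.
  - exact/increment_eqE.
  - by apply/eqP; rewrite -subr_eq0 Mv.
  - by rewrite -pS subrK.
  - exact/increment_eqE.
  - by rewrite Mv subrr.
  - by rewrite pS addrK.
split=> [dae | [scheme incr0] k].
  split=> [k|]; last by have /stepE[] := dae 0%N.
  by have /stepE[vtE _ vE pE] := dae k; have /stepE[_ incr _ _] := dae k.+1.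
apply/stepE; have [vtE _ vE pE] := scheme k; split=> //.
by case: k {vtE vE pE} => [//|k]; have [] := scheme k.
Qed.

(** The three nonzero row blocks of E have full rank 2n + m, so both the kernel
    and the cokernel of E have dimension m, and [pair_index1_compression]
    reduces the claim to [schur_unit]. *)
Lemma proj_pair_index1 :
  (0 < m)%N -> sym_posdef M -> \rank B = m -> tau != 0 ->
  pair_index (proj_E M B tau) (proj_A M A B tau) 1.
Proof.
move=> m_gt0 Mspd B_full tau0; have Mu := sym_posdef_unit _ _ _ Mspd.
have rs : ((n + (n + m)) + m)%N = (n + (m + (n + m)))%N by rewrite addnCA addnC addnCA.
(* The columns of Y solve
     M vt / tau = a,  M v - (M vt + (tau / 2) B^T phi) = b,  p - phi = c
   with phi = 0, which fixes one preimage modulo the kernel of E. *)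
pose Y : 'M[R]_(n + (m + (n + m)), n + (n + m)) :=
  col4 (row_mx (tau *: invmx M) 0) 0
       (row_mx (tau *: invmx M) (row_mx (invmx M) 0)) (row_mx 0 (row_mx 0 1%:M)).
pose X : 'M[R]_(n + (n + m), n + (m + (n + m))) :=
  col_mx (row4 1%:M 0 0 0) (col_mx (row4 0 0 1%:M 0) (row4 0 0 0 1%:M)).
pose U : 'M[R]_(m, n + (m + (n + m))) := row4 0 1%:M 0 0.
(* The kernel of E, parametrized by phi. *)
pose V : 'M[R]_(n + (m + (n + m)), m) :=
  col4 0 1%:M ((tau / 2) *: (invmx M *m B^T)) 1%:M.
apply: (@pair_index1_compression _ _ _ _ _ _ X Y U V) => //.
- rewrite -mulmxA mul_proj_E /X /col4 /row4 !mul_col_mx !mul_row_col.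
  rewrite !mul1mx !mul0mx !mulmx0 !scaler0 !addr0 !add0r subr0.
  rewrite !mul_mx_row -!scalemxAr !mulmxV // !mulmx0 scale_row_mx scaler0.
  rewrite scalerA mulVf // scale1r opp_row_mx add_row_mx subrr oppr0 addr0.
  by rewrite -block_mxEv block_mxEh col_mx0 -!block_mxEv -!scalar_mx_block.
- rewrite /U /proj_E /row4 /col4 !mul_row_col !mul0mx mul1mx !addr0 !add0r.
  by rewrite !row_mx0.
- rewrite mul_proj_E !mulmx0 scaler0 mulmx1 add0r subrr.
  by rewrite -scalemxAr mulKVmx // subrr /col4 !col_mx0.
(* The compression is - B M^-1 B^T. *)
- rewrite -mulmxA mul_proj_A /U /row4 /col4 !mul_row_col !mul0mx mul1mx.
  rewrite !addr0 !add0r mulmx0 scaler0 oppr0 add0r mulmx1 -scaleN1r.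
  by rewrite unitmxZ ?unitrN1 ?schur_unit.
Qed.

End Scheme.

(* Shifting the second equation of the scheme makes it hold also at time 0,
   whence the extra condition on the initial values in the last conjunct. *)
Theorem mainTheorem3 (R : realType) (m n : nat) (M A : 'M[R]_n)
    (B : 'M[R]_(m, n)) (tau : R)
    (m_gt0 : (0 < m)%N) (lt_mn : (m < n)%N)
    (M_spd : sym_posdef M) (B_full : \rank B = m) (tau_gt0 : 0 < tau) :
  [/\ regular_pair (proj_E M B tau) (proj_A M A B tau),
      pair_index (proj_E M B tau) (proj_A M A B tau) 1
    & forall (f : nat -> 'cV[R]_n) (g : nat -> 'cV[R]_m)
             (vt : nat -> 'cV[R]_n) (phi : nat -> 'cV[R]_m)
             (v : nat -> 'cV[R]_n) (p : nat -> 'cV[R]_m),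
        solves_dae (proj_E M B tau) (proj_A M A B tau)
                   (proj_state vt phi v p) (proj_rhs tau f g)
        <-> projection_scheme M A B tau f g vt phi v p
            /\ increment_eq M B tau (vt 0%N) (phi 0%N) (g 0%N)].
Proof.
have tau0 : tau != 0 by rewrite gt_eqF.
have idx := @proj_pair_index1 R m n M A B tau m_gt0 M_spd B_full tau0.
split; [exact: pair_index_regular _ _ _ _ _ idx | exact: idx |].
by move=> f g vt phi v p; exact: solves_dae_projection_scheme.
Qed.
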